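(* Let $p=\sum_{j=1}^t b_j\mathbf x^{\boldsymbol\alpha(j)}\in\mathbb{R}[x_1,\dots,x_n]$ with all $b_j\neq0$ and distinct $\boldsymbol\alpha(j)\in\mathbb{N}^n$, let $\mathbf A$ be the $n\times t$ matrix with columns $\boldsymbol\alpha(1),\dots,\boldsymbol\alpha(t)$, and let $\mathbf b=(b_1,\dots,b_t)$. Computing the orthants with minimal (effective) coefficient vector of $p$ is fixed-parameter tractable in $n$, via the following algorithm. Input: the polynomial $p$. Output: a set $M$ of orthants where the coefficients of $p$ have minimal effective sign (each orthant $\sigma$ being stored as a pair $(v,\sigma)$). Start with $M=\emptyset$. For each $\sigma\in\{0,1\}^n$ (as a row vector), i.e. for each orthant, compute $v=(\sigma\mathbf A+\operatorname{neg}(\mathbf b))\bmod 2\in\{0,1\}^t$. Go through the pairs $(e,s)\in M$: if $e\le v$, then $v$ is regarded as not minimal, and one continues with the next $\sigma$; if $v<e$, then $e$ is regarded as not minimal, and $(e,s)$ is removed from $M$. If the end of this loop over $M$ is reached, $v$ is regarded as minimal and $(v,\sigma)$ is added to $M$.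
   Context: The function $\operatorname{neg}$ is the indicator function of strictly negative numbers: $\operatorname{neg}(y)=1$ if $y<0$ and $\operatorname{neg}(y)=0$ if $y\ge0$, applied entrywise to vectors. A vector $\sigma\in\{0,1\}^n$ encodes the orthant in which $x_i$ is negative if $\sigma_i=1$ and positive if $\sigma_i=0$. Once the orthant is fixed, the sign of every variable is known, so the effective sign of each term of $p$ (whether the term is positive or negative on that orthant) is known; the effective coefficient vector of $p$ on the orthant is $\big((-1)^{\langle\sigma,\boldsymbol\alpha(j)\rangle}b_j\big)_{j=1,\dots,t}$. The entry $v_j$ computed in the algorithm equals $1$ exactly when the $j$-th effective coefficient is negative. Effective coefficient vectors are partially ordered by entrywise $\le$, and ''minimal'' refers to this partial order among the effective coefficient vectors of all $2^n$ orthants. In the algorithm, the vectors $e,v\in\{0,1\}^t$ are compared entrywise, and $v<e$ means $v\le e$ and $v\neq e$. Fixed-parameter tractable in $n$ means that there are a computable function $f:\mathbb{N}\to\mathbb{N}$ and a constant $c$ such that the running time on every input $p$ in $n$ variables of input length $L$ is $\mathcal{O}(f(n)\cdot L^{c})$, where $p$ is given in sparse form by the pair $(\mathbf A,\mathbf b)$.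
   Formalization: As printed, e≤v and v<e on 0/1 entries keep maximal effective coefficient vectors (p=x gives σ=0, not σ=1). The theorem compares v, e with 1 (negative) below 0 for the main claim, and separately shows that the printed tests yield the orthants with entrywise minimal v. *)

(* Defs.v *)
From Stdlib Require Import String.
From mathcomp Require Import all_boot all_order all_algebra.
From mathcomp Require Import reals mpoly.

Set Implicit Arguments.
Unset Strict Implicit.
Unset Printing Implicit Defensive.

Import Order.TTheory GRing.Theory Num.Theory.
Local Open Scope ring_scope.

(** * Machine model

    The WHILE language of N. D. Jones (Computability and Complexity from a
    Programming Perspective): data are binary trees, every operation on trees
    costs one unit, and the model is polynomially equivalent to Turing
    machines.  So that polynomials may have arbitrary real coefficients, a leaf
    may also hold an element of R.  Such a leaf has size one, and the only thing
    a program can do with it, apart from copying it, is to test whether it is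
    negative.  For coefficients given by finite codes, the size of a datum is
    therefore a lower bound for its bit length. *)

Inductive data (R : Type) : Type :=
  | Atom of R
  | Nil
  | Cons of data R & data R.
Arguments Nil {R}.

Fixpoint dsize (R : Type) (d : data R) : nat :=
  if d is Cons d1 d2 then (dsize d1 + dsize d2).+1 else 1%N.

Definition var := string.

Inductive expr : Type :=
  | EVar of var
  | ENil
  | ECons of expr & expr
  | EHd of expr
  | ETl of expr
  | ENeg of expr.

Inductive cmd : Type :=
  | Skip
  | Assign of var & expr
  | Seq of cmd & cmd
  | If of expr & cmd & cmd
  | While of expr & cmd.

Definition store (R : Type) := var -> data R.

Definition update (R : Type) (s : store R) (x : var) (d : data R) : store R :=
  fun y => if String.eqb x y then d else s y.

(** Nil is false, everything else is true. *)
Definition truth (R : Type) (d : data R) : bool := if d is Nil then false else true.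

Definition enc_bool (R : Type) (b : bool) : data R :=
  if b then Cons Nil Nil else Nil.

Definition dhd (R : Type) (d : data R) : data R := if d is Cons d1 _ then d1 else Nil.
Definition dtl (R : Type) (d : data R) : data R := if d is Cons _ d2 then d2 else Nil.

Definition neg (R : numDomainType) (y : R) : bool := y < 0.

Fixpoint eval (R : numDomainType) (s : store R) (e : expr) : data R :=
  match e with
  | EVar x => s x
  | ENil => Nil
  | ECons e1 e2 => Cons (eval s e1) (eval s e2)
  | EHd e1 => dhd (eval s e1)
  | ETl e1 => dtl (eval s e1)
  | ENeg e1 => if eval s e1 is Atom r then enc_bool R (neg r) else Nil
  end.

Fixpoint cost (e : expr) : nat :=
  match e with
  | EVar _ | ENil => 1
  | ECons e1 e2 => (cost e1 + cost e2).+1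
  | EHd e1 | ETl e1 | ENeg e1 => (cost e1).+1
  end.

(** [exec c s T s']: started in store [s], the command [c] halts in store [s']
    after exactly [T] time units. *)
Inductive exec (R : numDomainType) : cmd -> store R -> nat -> store R -> Prop :=
  | ExecSkip s : exec Skip s 1 s
  | ExecAssign x e s :
      exec (Assign x e) s (cost e).+1 (update s x (eval s e))
  | ExecSeq c1 c2 s1 s2 s3 T1 T2 :
      exec c1 s1 T1 s2 -> exec c2 s2 T2 s3 -> exec (Seq c1 c2) s1 (T1 + T2)%N s3
  | ExecIf e c1 c2 s s' T :
      exec (if truth (eval s e) then c1 else c2) s T s' ->
      exec (If e c1 c2) s ((cost e).+1 + T)%N s'
  | ExecWhileF e c s :
      ~~ truth (eval s e) -> exec (While e c) s (cost e).+1 s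
  | ExecWhileT e c s1 s2 s3 T1 T2 :
      truth (eval s1 e) -> exec c s1 T1 s2 -> exec (While e c) s2 T2 s3 ->
      exec (While e c) s1 ((cost e).+1 + T1 + T2)%N s3.

Definition init (R : Type) (d : data R) : store R :=
  fun x => if String.eqb x "in" then d else Nil.

Definition result (R : Type) (s : store R) : data R := s "out"%string.

Definition enc_list (R : Type) (ds : seq (data R)) : data R :=
  foldr (@Cons R) Nil ds.

Definition enc_unary (R : Type) (n : nat) : data R := enc_list (nseq n Nil).

(** Unary inputs contain no element of R, so this is ordinary computability,
    whatever R is. *)
Definition computable (R : numDomainType) (f : nat -> nat) : Prop :=
  exists c : cmd, forall n : nat, exists (T : nat) (s : store R),
    exec c (init (enc_unary R n)) T s /\ result s = enc_unary R (f n).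

(** The program [c] solves a problem with instances in [I] in fixed-parameter
    tractable time: [enc] encodes the instances, [param] is the parameter, and
    [post i d] says that [d] is a correct output for the instance [i]. *)
Definition fpt_by (R : numDomainType) (I : Type) (enc : I -> data R)
    (param : I -> nat) (post : I -> data R -> Prop) (c : cmd) : Prop :=
  exists (f : nat -> nat) (C k : nat), computable R f /\
    forall i : I, exists (T : nat) (s : store R),
      [/\ exec c (init (enc i)) T s,
          post i (result s)
        & (T <= C * (f (param i) * dsize (enc i) ^ k))%N].

(** * Polynomials in sparse form *)

Record sparsePoly (R : realType) : Type := SparsePoly {
  nvars : nat;
  nterms : nat;
  poly_of : {mpoly R[nvars]};
  expmx : 'M[nat]_(nvars, nterms);
  coefv : 'rV[R]_nterms;
  coefv_neq0 : forall j, coefv 0 j != 0;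
  expmx_inj : injective (fun j => col j expmx);
  poly_ofE :
    poly_of = \sum_j coefv 0 j *: 'X_[ [multinom expmx i j | i < nvars] ]
}.

(** Binary numerals, least significant bit first; zero is the empty numeral. *)
Fixpoint pos_bits (m : BinNums.positive) : seq bool :=
  match m with
  | BinNums.xH => [:: true]
  | BinNums.xO m' => false :: pos_bits m'
  | BinNums.xI m' => true :: pos_bits m'
  end.

Definition nat_bits (k : nat) : seq bool :=
  if bin_of_nat k is BinNums.Npos m then pos_bits m else [::].

Definition enc_bits (R : Type) (bs : seq bool) : data R :=
  enc_list [seq enc_bool R b | b <- bs].

(** The triple (n, A, b): n in unary (it cannot be read off A when A has no
    columns), A as the list of its columns, b as a list of atoms. *)
Definition enc_input (R : realType) (p : sparsePoly R) : data R :=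
  Cons (enc_unary R (nvars p))
    (Cons
      (enc_list [seq enc_list [seq enc_bits R (nat_bits (expmx p i j))
                              | i <- enum 'I_(nvars p)]
                | j <- enum 'I_(nterms p)])
      (enc_list [seq Atom (coefv p 0 j) | j <- enum 'I_(nterms p)])).

(** * Orthants

    [sigma 0 i] tells whether x_i is negative. *)

Definition orthant n := 'rV[bool]_n.

(** sigma A *)
Definition orthant_exp n t (A : 'M[nat]_(n, t)) (sigma : orthant n) : 'rV[nat]_t :=
  map_mx nat_of_bool sigma *m A.

Definition effcoef (R : realType) (p : sparsePoly R) (sigma : orthant (nvars p))
    : 'rV[R]_(nterms p) :=
  \row_j ((-1) ^+ (orthant_exp (expmx p) sigma 0 j) * coefv p 0 j).

(** (sigma A + neg b) mod 2 *)
Definition signvec (R : realType) (p : sparsePoly R) (sigma : orthant (nvars p))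
    : 'rV[bool]_(nterms p) :=
  map_mx odd (orthant_exp (expmx p) sigma
              + map_mx (fun y => nat_of_bool (neg y)) (coefv p)).

Definition rv_le d (T : porderType d) t (u v : 'rV[T]_t) : Prop :=
  forall j, (u 0 j <= v 0 j)%O.

Definition minimal_at (X : Type) d (T : porderType d) t (g : X -> 'rV[T]_t) (x : X)
    : Prop :=
  forall y : X, rv_le (g y) (g x) -> g y = g x.

(** Of several orthants with the same vector only one is listed, since a vector
    which is already present is not added again. *)
Definition lists_minimal (R : realType) (p : sparsePoly R) d (T : porderType d) t
    (g : orthant (nvars p) -> 'rV[T]_t)
    (M : seq ('rV[bool]_(nterms p) * orthant (nvars p))) : Prop :=
  [/\ uniq M,
      forall m, m \in M -> m.1 = signvec m.2 /\ minimal_at g m.2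
    & forall sigma, minimal_at g sigma ->
        exists! m, m \in M /\ g m.2 = g sigma].

Definition enc_rv (R : Type) t (v : 'rV[bool]_t) : data R :=
  enc_bits R [seq v 0 j | j <- enum 'I_t].

Definition enc_output (R : Type) n t (M : seq ('rV[bool]_t * orthant n)) : data R :=
  enc_list [seq Cons (enc_rv R m.1) (enc_rv R m.2) | m <- M].

(** * The algorithm *)

Declare Scope while_scope.
Delimit Scope while_scope with while.
Local Open Scope string_scope.
Local Open Scope while_scope.
Notation "x ::= e" := (Assign x%string e)
  (at level 70, e at level 69) : while_scope.
Notation "c1 ;; c2" := (Seq c1 c2)
  (at level 90, right associativity) : while_scope.

Definition ETrue := ECons ENil ENil.
Definition EFalse := ENil.
Definition V (x : var) : expr := EVar x.

(** Executes [c] with [x] running through the list [e]; the list is evaluated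
    once, before the first iteration. *)
Definition Foreach (x : var) (e : expr) (c : cmd) : cmd :=
  let todo := String.append "todo " x in
  todo ::= e ;;
  While (V todo) (x ::= EHd (V todo) ;; todo ::= ETl (V todo) ;; c).

Definition Flip (x : var) : cmd := If (V x) (x ::= EFalse) (x ::= ETrue).

(** [r] tells whether the bit list [x] is entrywise at most the bit list [y]. *)
Definition BitLeq (r x y : var) : cmd :=
  r ::= ETrue ;;
  "ys" ::= V y ;;
  Foreach "xj" (V x) (
    If (V "xj") (If (EHd (V "ys")) Skip (r ::= EFalse)) Skip ;;
    "ys" ::= ETl (V "ys")).

(** The same for the signs which the bits stand for: 1 stands for a negative
    sign, hence is smaller than 0. *)
Definition SignLeq (r x y : var) : cmd := BitLeq r y x.

(** All bit vectors of length n. *)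
Definition ListOrthants : cmd :=
  "orthants" ::= ECons ENil ENil ;;
  Foreach "i" (V "n") (
    "longer" ::= ENil ;;
    Foreach "s" (V "orthants") (
      "longer" ::= ECons (ECons ETrue (V "s"))
                         (ECons (ECons EFalse (V "s")) (V "longer"))) ;;
    "orthants" ::= V "longer").

(** v := (sigma A + neg b) mod 2.  The head of a binary numeral is its parity. *)
Definition ComputeV : cmd :=
  "rev v" ::= ENil ;;
  "bs" ::= V "b" ;;
  Foreach "alpha" (V "A") (
    "vj" ::= ENeg (EHd (V "bs")) ;;
    "bs" ::= ETl (V "bs") ;;
    "alphas" ::= V "alpha" ;;
    Foreach "sigma i" (V "sigma") (
      If (V "sigma i") (If (EHd (EHd (V "alphas"))) (Flip "vj") Skip) Skip ;;
      "alphas" ::= ETl (V "alphas")) ;;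
    "rev v" ::= ECons (V "vj") (V "rev v")) ;;
  "v" ::= ENil ;;
  Foreach "vj" (V "rev v") ("v" ::= ECons (V "vj") (V "v")).

(** [Leq r x y] stores in [r] whether x <= y.  Once [v] is known not to be
    minimal, the remaining pairs of [M] are kept without being examined.  In the
    second comparison e <= v is already known to fail, so that v <= e amounts to
    v < e. *)
Definition MinimalOrthants (Leq : var -> var -> var -> cmd) : cmd :=
  "n" ::= EHd (V "in") ;;
  "A" ::= EHd (ETl (V "in")) ;;
  "b" ::= ETl (ETl (V "in")) ;;
  ListOrthants ;;
  "M" ::= ENil ;;
  Foreach "sigma" (V "orthants") (
    ComputeV ;;
    "minimal" ::= ETrue ;;
    "kept" ::= ENil ;;
    Foreach "pair" (V "M") (
      "keep" ::= ETrue ;;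
      If (V "minimal") (
        "e" ::= EHd (V "pair") ;;
        Leq "e <= v" "e" "v" ;;
        If (V "e <= v") ("minimal" ::= EFalse) (
          Leq "v <= e" "v" "e" ;;
          If (V "v <= e") ("keep" ::= EFalse) Skip)) Skip ;;
      If (V "keep") ("kept" ::= ECons (V "pair") (V "kept")) Skip) ;;
    "M" ::= V "kept" ;;
    If (V "minimal") ("M" ::= ECons (ECons (V "v") (V "sigma")) (V "M")) Skip) ;;
  "out" ::= V "M".

(* Main.v *)
Require Import Defs.
From Stdlib Require Import String.
From mathcomp Require Import all_boot all_order all_algebra.
From mathcomp Require Import reals mpoly zify lra.

(* Write le for the order by which the sign vectors are compared.  After every
   outer iteration the pairs of M form an antichain for le, and every orthant
   treated so far is dominated by some pair of M.  Once all orthants have been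
   treated, an antichain that dominates everything consists of exactly the
   minimal vectors, each listed once.  As the coefficients are nonzero, an
   effective coefficient is (-1)^(v_j) |b_j|, so comparing effective coefficient
   vectors is comparing the vectors v as signs.  M never has more than 2^n
   pairs, and each of the 2^n outer iterations computes v in time O(t n) and
   makes O(|M|) comparisons in time O(t): this gives O(4^n (t+1) (n+1)). *)

Set Implicit Arguments.
Unset Strict Implicit.
Unset Printing Implicit Defensive.

Import Order.TTheory GRing.Theory Num.Theory.
Local Open Scope string_scope.
Local Open Scope nat_scope.
Local Open Scope seq_scope.
Local Open Scope while_scope.

(** * Program logic with time bounds *)

(** A syntactic upper bound on the variables a command can change. Being boolean, it settles frame
    conditions on concrete programs by computation. *)
Fixpoint assigns (c : cmd) (x : var) : bool :=
  match c with
  | Skip => false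
  | Assign y _ => String.eqb y x
  | Seq c1 c2 | If _ c1 c2 => assigns c1 x || assigns c2 x
  | While _ c1 => assigns c1 x
  end.

Lemma assigns_foreach x e c z (todo := String.append "todo " x) :
  assigns (Foreach x e c) z =
  [|| String.eqb todo z, String.eqb x z, String.eqb todo z | assigns c z].
Proof. by []. Qed.

Section Logic.
Variable R : numDomainType.
Implicit Types (s : store R) (c : cmd) (e : expr) (Q : store R -> Prop).

Definition agree c s s' := forall x, ~~ assigns c x -> s' x = s x.

Lemma exec_agree c s T s' : exec c s T s' -> agree c s s'.
Proof.
elim=> {c s T s'} //.
- by move=> x e s y /= /negbTE; rewrite /update => ->.
- move=> c1 c2 s1 s2 s3 T1 T2 _ IH1 _ IH2 x /=.
  by rewrite negb_or => /andP[h1 h2]; rewrite IH2 ?IH1.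
- move=> e c1 c2 s s' T _ IH x /=; rewrite negb_or => /andP[h1 h2].
  by apply: IH; case: truth.
- by move=> e c s1 s2 s3 T1 T2 _ _ IH1 _ IH2 x /= h; rewrite IH2 ?IH1.
Qed.

(** A total-correctness triple. [B] is only an upper bound, so budgets can be rounded up, and [Q]
    acts as a continuation when a program is traversed from front to back. *)
Definition halts c s (B : nat) Q :=
  exists T s', [/\ exec c s T s', T <= B & Q s'].

(** Frame rule: thanks to it, loop invariants need mention only the variables that change. *)
Lemma halts_agree c s B Q :
  halts c s B (fun s' => agree c s s' -> Q s') -> halts c s B Q.
Proof.
move=> [T [s' [ex le_TB Qs']]]; exists T, s'; split=> //.
exact: Qs' (exec_agree ex).
Qed.

Lemma halts_weaken c s B B' Q Q' :
  halts c s B' Q' -> B' <= B -> (forall s', Q' s' -> Q s') -> halts c s B Q.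
Proof.
move=> [T [s' [ex le_TB Qs']]] le_BB QQ; exists T, s'; split=> //; last exact: QQ.
exact: leq_trans le_BB.
Qed.

Lemma halts_skip s B Q : 0 < B -> Q s -> halts Skip s B Q.
Proof. by move=> B_gt0 Qs; exists 1, s; split=> //; apply: ExecSkip. Qed.

Lemma halts_assign x e s B Q :
  cost e < B -> Q (update s x (eval s e)) -> halts (x ::= e) s B Q.
Proof. by move=> le_B Qs; do 2!eexists; split; first exact: ExecAssign. Qed.

Lemma halts_seq B1 c1 c2 s B Q :
    B1 <= B -> halts c1 s B1 (fun s1 => halts c2 s1 (B - B1) Q) ->
  halts (c1 ;; c2) s B Q.
Proof.
move=> le_B1 [T1 [s1 [ex1 le1 [T2 [s2 [ex2 le2 Qs]]]]]].
exists (T1 + T2), s2; split=> //; last by lia.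
exact: ExecSeq ex1 ex2.
Qed.

Lemma halts_assign_seq x e c s B Q :
    cost e < B -> halts c (update s x (eval s e)) (B - (cost e).+1) Q ->
  halts (x ::= e ;; c) s B Q.
Proof. by move=> le_B h; apply: (halts_seq le_B); apply: halts_assign. Qed.

Lemma halts_if e c1 c2 s B Q :
    cost e < B ->
    halts (if truth (eval s e) then c1 else c2) s (B - (cost e).+1) Q ->
  halts (If e c1 c2) s B Q.
Proof.
move=> le_B [T [s' [ex le_T Qs]]]; exists ((cost e).+1 + T), s'.
by split=> //; [apply: ExecIf | lia].
Qed.

(** The invariant [J] takes the list of items still to be treated. An iteration costs 8 beyond its
    body: 2 for the test and 3 for each of the two assignments. The [3] added to [cost e] pays for
    the initial assignment and the failing last test. *)
Lemma halts_foreach (X : Type) (enc : X -> data R) (J : seq X -> store R -> Prop)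
    Bc l x e c s B Q (todo := String.append "todo " x) :
    eval s e = enc_list (map enc l) ->
    String.eqb x todo = false -> ~~ assigns c todo ->
    cost e + 3 + size l * (8 + Bc) <= B ->
    J l (update s todo (eval s e)) ->
    (forall y rest s', agree (Foreach x e c) s s' -> J (y :: rest) s' ->
      halts c (update (update s' x (enc y)) todo (enc_list (map enc rest))) Bc
        (J rest)) ->
    (forall s', agree (Foreach x e c) s s' -> J [::] s' -> Q s') ->
  halts (Foreach x e c) s B Q.
Proof.
move=> def_e x_todo c_todo le_B J0 Jstep JQ; apply: halts_agree.
set D := (agree _ _) in Jstep JQ *.
have Dtodo s1 s2 d : D s1 -> (forall z, z <> x -> z <> todo -> ~~ assigns c z ->
    s2 z = s1 z) -> D (update s2 todo d).
  move=> D1 eq12 z Hz; move: (Hz); rewrite assigns_foreach !negb_or.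
  case/and4P=> /negbTE zt /negbTE zx _ zc; rewrite /update zt eq12 ?D1 //.
    by move=> zE; rewrite zE String.eqb_refl in zx.
  by move=> zE; rewrite zE String.eqb_refl in zt.
have D0 : D (update s todo (eval s e)) by apply: (Dtodo s).
apply: (@halts_seq (cost e).+1); first by lia.
apply: halts_assign => //.
set s0 := update _ _ _ in J0 D0 *.
have s0_todo : s0 todo = enc_list (map enc l).
  by rewrite /s0 /update String.eqb_refl.
have {le_B} le_B: 2 + size l * (8 + Bc) <= B - (cost e).+1 by lia.
move: {J0 s0_todo D0 le_B def_e} (B - _) (s0) J0 s0_todo D0 le_B => {s0}.
elim: l => [|y l IH] B' s1 J1 todo1 D1 /= le_B.
  exists 2, s1; split; [|by lia|by move=> ?; apply: JQ].
  by apply: (@ExecWhileF _ (V todo)); rewrite /= todo1.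
pose s2 := update (update s1 x (enc y)) todo (enc_list (map enc l)).
have [T2 [s3 [ex3 le_T2 J3]]] := Jstep _ _ _ D1 J1.
have fr3 := exec_agree ex3.
have [|||T4 [s4 [ex4 le_T4 Q4]]] := IH (B' - (8 + Bc)) s3 J3.
- by rewrite fr3 // /update String.eqb_refl.
- move=> z Hz; rewrite fr3; last first.
    by move: Hz; rewrite assigns_foreach !negb_or => /and4P[].
  by apply: Dtodo Hz; [exact: D1|move=> u ux _ _; rewrite /update; case: String.eqb_spec => // /esym].
- by lia.
exists ((cost (V todo)).+1 + (3 + (3 + T2)) + T4), s4; split=> //; last by rewrite /=; lia.
apply: ExecWhileT ex4; first by rewrite /= todo1.
apply: ExecSeq; first exact: ExecAssign.
apply: ExecSeq; first exact: ExecAssign.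
suff <- : s2 = update (update s1 x (eval s1 (EHd (V todo)))) todo
  (eval (update s1 x (eval s1 (EHd (V todo)))) (ETl (V todo))) by [].
by rewrite /= /s2 {5}/update x_todo todo1.
Qed.

End Logic.

Arguments update : simpl never.

Section Update.
Variable R : Type.
Implicit Types s : store R.

Lemma update_eq s x d : update s x d x = d.
Proof. by rewrite /update String.eqb_refl. Qed.

Lemma update_neq s x d y : String.eqb x y = false -> update s x d y = s y.
Proof. by rewrite /update => ->. Qed.

Lemma truth_enc_bool b : truth (enc_bool R b) = b.
Proof. by case: b. Qed.

End Update.

Definition updE := (update_eq, update_neq).

(** * Entrywise comparison of bit vectors and parity of numerals *)

Definition bitle t (u w : 'rV[bool]_t) : bool := [forall j, u ord0 j ==> w ord0 j].

Section Programs.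
Variable R : numDomainType.
Implicit Types s : store R.

Lemma enc_rvE t (u : 'rV[bool]_t) :
  enc_rv R u = enc_list [seq enc_bool R (u ord0 j) | j <- enum 'I_t].
Proof. by rewrite /enc_rv /enc_bits -map_comp. Qed.

(** The names [r], [x], [y] are parameters, so the absence of harmful aliasing has to be assumed;
    for concrete names each condition holds by computation. *)
Lemma bitleq_halts t (u w : 'rV[bool]_t) r x y s B Q :
    String.eqb r "ys" = false -> String.eqb r "xj" = false ->
    String.eqb r "todo xj" = false -> String.eqb "ys" r = false ->
    String.eqb "ys" x = false -> String.eqb r x = false -> String.eqb r y = false ->
    String.eqb "xj" r = false -> String.eqb "todo xj" r = false ->
    s x = enc_rv R u -> s y = enc_rv R w -> 30 * t.+1 <= B ->
    (forall s', agree (BitLeq r x y) s s' -> s' r = enc_bool R (bitle u w) -> Q s') ->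
  halts (BitLeq r x y) s B Q.
Proof.
move=> rys rxj rt ysr ysx rx ry xjr tr sx sy le_B HQ.
apply: halts_agree; apply: halts_assign_seq => /=; first by lia.
apply: halts_assign_seq => /=; first by lia.
set s1 := update _ "ys" _.
(* The flag so far, conjoined with the tests still to come, always equals the full comparison. *)
apply: (@halts_foreach _ _ (fun j => enc_bool R (u ord0 j)) (fun rest s' =>
   s' "ys" = enc_list [seq enc_bool R (w ord0 j) | j <- rest] /\
   exists2 r0, s' r = enc_bool R r0 &
     r0 && all (fun j => u ord0 j ==> w ord0 j) rest = bitle u w)
   15 (enum 'I_t)) => //=.
- by rewrite /s1 !updE // sx enc_rvE.
- by rewrite rt.
- by rewrite size_enum_ord; lia.
- split; first by rewrite updE // /s1 updE /= updE // sy enc_rvE.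
  exists true; first by rewrite updE // /s1 !updE.
  by apply/allP/forallP => [H j | H j _]; apply: H; rewrite ?mem_enum.
- move=> j rest s' _ [ys [r0 s'r IH]].
  apply: (@halts_seq _ 12) => //; apply: halts_if => //.
  (* The assignment that ends the body, shared by the three branches. *)
  have K b : r0 && (u ord0 j ==> w ord0 j) = b ->
    forall s1, s1 "ys" = s' "ys" -> s1 r = enc_bool R b ->
    halts ("ys" ::= ETl (V "ys")) s1 3 (fun s2 =>
      s2 "ys" = enc_list [seq enc_bool R (w ord0 j0) | j0 <- rest] /\
      (exists2 r1 : bool, s2 r = enc_bool R r1 &
       r1 && all (fun j0 : 'I_t => u ord0 j0 ==> w ord0 j0) rest = bitle u w)).
    move=> <- s2 ys2 r2; apply: halts_assign => //; split.
      by rewrite updE /= ys2 ys.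
    by exists (r0 && (u ord0 j ==> w ord0 j)); rewrite ?updE // -IH /= andbA.
  rewrite /= !updE // truth_enc_bool; case: ifP => uj.
    apply: halts_if => //=; rewrite !updE // ys /= truth_enc_bool.
    case: ifP => wj.
      apply: halts_skip => //; apply: K; last by rewrite !updE // s'r.
        by rewrite uj wj andbT.
      by rewrite !updE.
    apply: halts_assign => //; apply: (K false); rewrite ?updE //.
    by rewrite uj wj andbF.
  apply: halts_skip => //; apply: K; last by rewrite !updE // s'r.
    by rewrite uj andbT.
  by rewrite !updE.
- move=> s' _ [_ [r0 s'r IH]] ag; apply: HQ; first exact: ag.
  by rewrite s'r -IH andbT.
Qed.

(** Numerals start with the least significant bit. For zero the numeral is empty, and the default
    head [Nil] is false, as it should be. *)
Lemma dhd_enc_bits k : truth (dhd (enc_bits R (nat_bits k))) = odd k.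
Proof.
rewrite -[k in RHS]bin_of_natK /nat_bits.
case: bin_of_nat => [|[p|p|]] //=; rewrite ?NatTrec.doubleE /= odd_double //.
Qed.

End Programs.

(** * Subprograms *)

Section Algorithm.
Variable R : numDomainType.
Implicit Types s : store R.

Lemma flip_halts x b s B (Q : store R -> Prop) :
    s x = enc_bool R b -> 6 <= B -> Q (update s x (enc_bool R (~~ b))) ->
  halts (Flip x) s B Q.
Proof.
move=> sx le_B Qs; apply: halts_if => /=; first by lia.
by rewrite sx truth_enc_bool; case: b Qs {sx} => Qs; apply: halts_assign => //=; lia.
Qed.

(** This is [signvec] with the polynomial unbundled into its exponent matrix and coefficients, to
    which it is convertible. *)
Definition sign_row n t (A : 'M[nat]_(n, t)) (b : 'rV[R]_t) (sigma : orthant n) :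
    'rV[bool]_t :=
  map_mx odd (orthant_exp A sigma + map_mx (fun y => nat_of_bool (neg y)) b)%R.

(** The parity of a sum is the exclusive or of the parities. This form matches the program, which
    starts from [neg] and flips once for each odd exponent of a negative variable. *)
Lemma sign_rowE n t (A : 'M[nat]_(n, t)) (b : 'rV[R]_t) sigma j :
  sign_row A b sigma ord0 j =
    neg (b ord0 j) (+)
      \big[addb/false]_(i <- enum 'I_n) (sigma ord0 i && odd (A i j)).
Proof.
rewrite !mxE oddD oddb addbC; congr (_ (+) _).
rewrite big_enum /= (big_morph odd (id1 := false) (op1 := addb) oddD) //.
by apply: eq_bigr => i _; rewrite !mxE oddM oddb.
Qed.

Definition enc_column n t (A : 'M[nat]_(n, t)) j : data R :=
  enc_list [seq enc_bits R (nat_bits (A i j)) | i <- enum 'I_n].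

Lemma computev_halts n t (A : 'M[nat]_(n, t)) (b : 'rV[R]_t) sigma s B Q :
    s "A" = enc_list [seq enc_column A j | j <- enum 'I_t] ->
    s "b" = enc_list [seq Atom (b ord0 j) | j <- enum 'I_t] ->
    s "sigma" = enc_rv R sigma ->
    100 * (t.+1 * n.+1) <= B ->
    (forall s', agree ComputeV s s' -> s' "v" = enc_rv R (sign_row A b sigma) ->
      Q s') ->
  halts ComputeV s B Q.
Proof.
move=> sA sb ss le_B HQ.
apply: halts_agree; apply: halts_assign_seq => /=; first by lia.
apply: halts_assign_seq => /=; first by lia.
set v := sign_row A b sigma in HQ *.
(* Here 4 is the fixed cost of a loop over a variable, 26 is 8 + 18, and 28 is the overhead 8 plus
   the inner body 20. *)
apply: (@halts_seq _ (4 + t * (26 + n.+1 * 28))); first by lia.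
apply: (@halts_foreach _ _ (enc_column A) (fun rest s' =>
   s' "bs" = enc_list [seq Atom (b ord0 j) | j <- rest] /\
   exists2 acc, s' "rev v" = enc_bits R acc &
     catrev acc [seq v ord0 j | j <- rest] = [seq v ord0 j | j <- enum 'I_t])
   (18 + n.+1 * 28) (enum 'I_t)) => //.
- by rewrite size_enum_ord /=; lia.
- by split; [rewrite !updE | exists [::]; rewrite ?updE].
- move=> j rest s' ag [sbs [acc srev IH]].
  have s'ss : s' "sigma" = enc_rv R sigma by rewrite ag.
  apply: halts_assign_seq => /=; first by lia.
  apply: halts_assign_seq => /=; first by lia.
  apply: halts_assign_seq => /=; first by lia.
  apply: (@halts_seq _ (4 + n * 28)); first by lia.
  (* Invariant: the current [vj], combined by exclusive or with the contributions still to come, is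
     the final entry. *)
  apply: (@halts_foreach _ _ (fun i => enc_bool R (sigma ord0 i)) (fun rest s' =>
    s' "alphas" = enc_list [seq enc_bits R (nat_bits (A i j)) | i <- rest] /\
    exists2 b0, s' "vj" = enc_bool R b0 &
    b0 (+) \big[addb/false]_(i <- rest) (sigma ord0 i && odd (A i j)) = v ord0 j)
    20 (enum 'I_n)) => //.
  + by rewrite /= !updE // s'ss enc_rvE.
  + by rewrite size_enum_ord.
  + split; first by rewrite !updE.
    exists (neg (b ord0 j)); last by rewrite /v sign_rowE.
    by rewrite !updE // sbs.
  + move=> i rest' s2 _ [sal [b0 svj IH2]].
    apply: (@halts_seq _ 17) => //; apply: halts_if => //.
    have K b1 : b1 = b0 (+) (sigma ord0 i && odd (A i j)) ->
      forall s1, s1 "alphas" = s2 "alphas" -> s1 "vj" = enc_bool R b1 ->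
      halts ("alphas" ::= ETl (V "alphas")) s1 3 (fun s3 =>
        s3 "alphas" = enc_list [seq enc_bits R (nat_bits (A i j)) | i <- rest'] /\
        exists2 b0, s3 "vj" = enc_bool R b0 &
        b0 (+) \big[addb/false]_(i <- rest') (sigma ord0 i && odd (A i j)) = v ord0 j).
      move=> -> s3 al3 vj3; apply: halts_assign => //; split.
        by rewrite updE /= al3 sal.
      exists (b0 (+) (sigma ord0 i && odd (A i j))); first by rewrite updE.
      by rewrite -addbA -IH2 big_cons.
    rewrite /= !updE // truth_enc_bool; case: ifP => si.
      apply: halts_if => //=; rewrite !updE // sal /= dhd_enc_bits.
      case: ifP => aij.
        apply: (@flip_halts _ b0) => //.
        apply: (K (~~ b0)); rewrite ?updE //.
        by rewrite si aij addbT.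
      by apply: halts_skip => //; apply: (K b0); rewrite ?updE // si aij addbF.
    by apply: halts_skip => //; apply: (K b0); rewrite ?updE // si addbF.
  + move=> s3 ag3 [_ [b0 svj bj]].
    apply: halts_assign => /=; first by lia.
    split; first by rewrite updE // ag3 // !updE // sbs.
    exists (b0 :: acc); first by rewrite updE // svj ag3 // !updE // srev.
    by rewrite -IH /= -bj big_nil addbF.
- move=> s1 ag1 [_ [acc srev accE]].
  apply: halts_assign_seq => /=; first by lia.
  have {accE} accE : rev acc = [seq v ord0 j | j <- enum 'I_t] by rewrite -accE.
  apply: (@halts_foreach _ _ (enc_bool R) (fun rest s' =>
   exists2 acc', s' "v" = enc_bits R acc' & catrev rest acc' = rev acc)
   4 acc) => //.
  + by rewrite -(size_rev acc) accE size_map size_enum_ord /=; lia.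
  + by exists [::].
  + move=> y rest s2 _ [acc' sv IH]; apply: halts_assign => //.
    by exists (y :: acc'); rewrite // !updE //= !updE // sv.
  + move=> s2 ag2 [acc' sv /= accE'] ag; apply: HQ => //.
    by rewrite sv accE' /enc_rv accE.
Qed.

Definition orthant_bits n (O : seq bitseq) :=
  [/\ uniq O, size O = 2 ^ n & forall w, (w \in O) = (size w == n)].

Definition extend_bits (acc : seq bitseq) (w : bitseq) :=
  (true :: w) :: (false :: w) :: acc.

(** The loop interleaves the two halves and reverses the order; uniqueness, size and membership are
    insensitive to this. *)
Lemma extend_bits_perm O acc :
  perm_eq (foldl extend_bits acc O)
          (map (cons true) O ++ map (cons false) O ++ acc).
Proof.
elim: O acc => [|w O IH] acc //=; rewrite (perm_trans (IH _)) //.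
rewrite /extend_bits; apply/permP=> a; rewrite /= !count_cat /= !count_cat /=; lia.
Qed.

Lemma orthant_bitsS n O :
  orthant_bits n O -> orthant_bits n.+1 (foldl extend_bits [::] O).
Proof.
have pE := extend_bits_perm O [::].
case=> O_uniq sO memO; split.
- rewrite (perm_uniq pE) cats0 cat_uniq !map_inj_uniq ?O_uniq ?andbT //=;
    try by move=> ? ? [].
  by apply/hasPn => w /mapP[w' _ ->]; apply/mapP => -[].
- by rewrite (perm_size pE) cats0 size_cat !size_map sO addnn -mul2n expnS.
- move=> w; rewrite (perm_mem pE) cats0 mem_cat.
  case: w => [|c w] /=.
    by apply/orP => -[] /mapP[].
  rewrite eqSS -memO; apply/orP/idP.
    by case=> /mapP[w' ? [_ ->]].
  by move=> Hw; case: c; [left | right]; apply/mapP; exists w.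
Qed.

Lemma listorthants_halts n s B Q :
    s "n" = enc_unary R n -> 50 * (n.+1 * 2 ^ n) <= B ->
    (forall s', agree ListOrthants s s' ->
      (exists2 O, orthant_bits n O & s' "orthants" = enc_list (map (enc_bits R) O)) ->
      Q s') ->
  halts ListOrthants s B Q.
Proof.
move=> sn le_B HQ; have n2_gt0 : 0 < 2 ^ n by rewrite expn_gt0.
have le_n2 := leq_pmulr n n2_gt0.
apply: halts_agree; apply: halts_assign_seq => /=; first by lia.
(* [n - size rest] counts the completed rounds, hence the current length of the bit lists. *)
apply: (@halts_foreach _ _ id (fun rest s' =>
   exists2 O, orthant_bits (n - size rest) O &
     size rest <= n /\ s' "orthants" = enc_list (map (enc_bits R) O))
   (8 + 2 ^ n * 20) (nseq n (@Defs.Nil R))) => //.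
- by rewrite map_id; apply: sn.
- by rewrite size_nseq /=; lia.
- exists [:: [::]]; last by rewrite size_nseq !updE.
  by rewrite size_nseq subnn; split=> // w; rewrite inE; case: w.
- move=> y rest s' _ [O HO [/= le_n sO]].
  have szO : size O <= 2 ^ n.
    by case: HO => _ -> _; rewrite leq_exp2l ?leq_subr.
  apply: halts_assign_seq => //.
  apply: (@halts_seq _ (4 + 2 ^ n * 20)); first by rewrite /=; lia.
  apply: (@halts_foreach _ _ (enc_bits R) (fun rest s' =>
     exists2 acc, s' "longer" = enc_list (map (enc_bits R) acc) &
       foldl extend_bits acc rest = foldl extend_bits [::] O) 12 O) => //.
  + by rewrite leq_add // leq_mul.
  + by exists [::].
  + move=> w rest' s2 _ [acc sl IH]; apply: halts_assign => //.
    by exists (extend_bits acc w); rewrite // updE /= !updE // sl.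
  + move=> s2 ag [acc sl /= accE]; apply: halts_assign; first by rewrite /=; lia.
    exists acc; last by rewrite updE; split=> //; lia.
    by have := orthant_bitsS HO; rewrite /= subnSK // -accE.
- move=> s' ag [O HO [_ sO]] ag'; apply: HQ => //.
  by exists O => //; move: HO; rewrite subn0.
Qed.

End Algorithm.

(** * The set of minimal pairs *)

Section Insertion.
Variables (T X : eqType) (le : rel T) (vec : X -> T).
Implicit Types (M K : seq (T * X)) (v : T) (m : T * X).

(** Functional model of the body of the loop over [M]; the state consists of the program variables
    [minimal] and [kept]. *)
Definition compare_pair v (bK : bool * seq (T * X)) m :=
  if bK.1 then
    if le m.1 v then (false, m :: bK.2)
    else if le v m.1 then (true, bK.2) else (true, m :: bK.2)
  else (false, m :: bK.2).

Definition scan v M := foldl (compare_pair v) (true, [::]) M.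

Definition insert M x :=
  let bK := scan (vec x) M in if bK.1 then (vec x, x) :: bK.2 else bK.2.

(** Keeps the size of [M] below the number of orthants treated, which bounds the cost of each pass
    over [M]. *)
Lemma size_insert M x : size (insert M x) <= (size M).+1.
Proof.
suff le_scan bK : size (foldl (compare_pair (vec x)) bK M).2 <= size bK.2 + size M.
  by have := le_scan (true, [::]); rewrite /insert /scan; case: ifP => /=; lia.
elim: M bK => [|m M IH] bK /=; first by rewrite addn0.
apply: leq_trans (IH _) _; rewrite /compare_pair addnS -addSn leq_add2r.
by case: ifP; do ?[case: ifP] => //=.
Qed.

Hypotheses (le_refl : reflexive le) (le_trans : transitive le).

(** For reflexive [le] this also rules out two pairs with the same vector and different orthants. *)
Definition antichain M := {in M &, forall m m', le m.1 m'.1 -> m = m'}.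

(* A pair e' is removed only if v <= e'.  If some later e satisfied e <= v, then
   e <= e' would give e = e' in an antichain, but e' <= v is tested first. *)
Lemma scanE v M : antichain M ->
  scan v M = if has (fun m => le m.1 v) M then (false, rev M)
             else (true, rev [seq m <- M | ~~ le v m.1]).
Proof.
have scan_false K M' : foldl (compare_pair v) (false, K) M' = (false, catrev M' K).
  by elim: M' K => //= m M' IH K; rewrite IH.
rewrite /scan /rev; elim: M [::] => //= m M IH K ac.
have ac' : antichain M by move=> m1 m2 h1 h2; apply: ac; rewrite inE ?h1 ?h2 orbT.
rewrite {2}/compare_pair /=; case: ifP => [mv | mv]; first by rewrite scan_false.
case: ifP => [vm | vm] /=; last by rewrite IH.
rewrite IH //; case: ifP => // /hasP[m' m'M m'v].
have m'm : m' = m.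
  by apply: ac (le_trans m'v vm); rewrite inE ?eqxx ?m'M ?orbT.
by rewrite -m'm m'v in mv.
Qed.

Definition minimal_pairs (D : seq X) M :=
  [/\ uniq M, antichain M, {in M, forall m, m.1 = vec m.2}
    & {in D, forall x, exists2 m, m \in M & le m.1 (vec x)}].

(** A rejected [x] is dominated by the pair that rejects it. If [x] is accepted, every removed pair
    lies above it, so by transitivity the new pair dominates whatever the removed ones did. *)
Lemma minimal_pairs_insert D M x :
  minimal_pairs D M -> minimal_pairs (x :: D) (insert M x).
Proof.
case=> M_uniq ac Mv dom; rewrite /insert (scanE _ ac).
case: (boolP (has (fun m => le m.1 (vec x)) M)) => /=.
  move=> /hasP[m0 m0M m0x]; split.
  - by rewrite rev_uniq.
  - by move=> m m'; rewrite !mem_rev; apply: ac.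
  - by move=> m; rewrite mem_rev; apply: Mv.
  - move=> y; rewrite inE => /predU1P[-> | /dom[m mM my]].
      by exists m0; rewrite ?mem_rev.
    by exists m; rewrite ?mem_rev.
move/hasPn=> nM; split.
(* Were the new pair already in [M], reflexivity would have led to rejection. *)
- rewrite /= mem_rev rev_uniq filter_uniq // mem_filter andbT.
  by apply/negP => /andP[_ /nM]; rewrite /= le_refl.
- move=> m m'; rewrite !inE !mem_rev !mem_filter.
  move=> /predU1P[-> | /andP[vm mM]] /predU1P[-> | /andP[vm' m'M]] //=.
  + by rewrite (negPf vm').
  + by rewrite (negPf (nM _ mM)).
  + exact: ac.
- move=> m; rewrite inE mem_rev mem_filter => /predU1P[-> // | /andP[_ mM]].
  exact: Mv.
- move=> y; rewrite inE => /predU1P[-> | /dom[m mM my]].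
    by exists (vec x, x); rewrite ?inE ?eqxx.
  case vm: (le (vec x) m.1).
    by exists (vec x, x); rewrite ?inE ?eqxx //; apply: le_trans vm my.
  by exists m; rewrite // inE mem_rev mem_filter vm mM orbT.
Qed.

Lemma minimal_pairs_foldl (l : seq X) :
  exists2 D, D =i l & minimal_pairs D (foldl insert [::] l).
Proof.
exists (rev l); first by move=> x; rewrite mem_rev.
elim/last_ind: l => [|l x IH]; first by split.
by rewrite foldl_rcons rev_rcons; apply: minimal_pairs_insert.
Qed.

End Insertion.

(* The variables assigned by [SwapLeq] do not depend on [sw], so that [assigns]
   computes on the programs that contain it. *)
Definition SwapLeq (sw : bool) (r x y : var) : cmd :=
  BitLeq r (if sw then y else x) (if sw then x else y).

(** With [sw] true, 1 lies below 0, as for signs. *)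
Definition swap_le t (sw : bool) (u w : 'rV[bool]_t) : bool :=
  if sw then bitle w u else bitle u w.

(** * Result and running time of the main program *)

Section MinimalOrthants.
Variable R : realType.
Implicit Types s : store R.

Lemma swapleq_halts t sw (u w : 'rV[bool]_t) r x y s B (Q : store R -> Prop) :
    String.eqb r "ys" = false -> String.eqb r "xj" = false ->
    String.eqb r "todo xj" = false -> String.eqb "ys" r = false ->
    String.eqb "ys" x = false -> String.eqb r x = false ->
    String.eqb "ys" y = false -> String.eqb r y = false ->
    String.eqb "xj" r = false -> String.eqb "todo xj" r = false ->
    s x = enc_rv R u -> s y = enc_rv R w -> 30 * t.+1 <= B ->
    (forall s', agree (SwapLeq sw r x y) s s' ->
      s' r = enc_bool R (swap_le sw u w) -> Q s') ->
  halts (SwapLeq sw r x y) s B Q.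
Proof.
rewrite /SwapLeq /swap_le; case: sw => *; first exact: (@bitleq_halts _ t w u).
exact: (@bitleq_halts _ t u w).
Qed.

Lemma minimal_orthants_halts (p : sparsePoly R) sw (n := nvars p) (t := nterms p) :
  exists (Os : seq (orthant n)) T s,
    [/\ uniq Os, forall sigma, sigma \in Os,
        exec (MinimalOrthants (SwapLeq sw)) (init (enc_input p)) T s,
        T <= 1000 * (4 ^ n * (t.+1 * n.+1)) &
        result s = enc_output R (foldl (insert (@swap_le t sw) (@signvec R p)) [::] Os)].
Proof.
suff [T [s [ex le_T [Os [? ? ?]]]]]: halts (MinimalOrthants (SwapLeq sw))
    (init (enc_input p)) (1000 * (4 ^ n * (t.+1 * n.+1))) (fun s =>
      exists Os : seq (orthant n), [/\ uniq Os, forall sigma, sigma \in Os &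
       result s = enc_output R (foldl (insert (@swap_le t sw) (@signvec R p)) [::] Os)]).
  by exists Os, T, s.
have n2_gt0 : 0 < 2 ^ n by rewrite expn_gt0.
have -> : 4 ^ n = 2 ^ n * 2 ^ n by rewrite -expnMn.
set N := 2 ^ n in n2_gt0 *; set B := 1000 * _.
(* The three terms pay for the comparisons, the computation of the vectors [v], and the listing of
   the orthants. *)
have le_B : 400 * (N * N * t.+1) + 400 * (N * (t.+1 * n.+1)) + 200 * (N * n.+1) <= B.
  by rewrite /B; nia.
have B1 : 1 <= N * n.+1 by nia.
apply: halts_assign_seq => /=; first by nia.
apply: halts_assign_seq => /=; first by nia.
apply: halts_assign_seq => /=; first by nia.
apply: (@halts_seq _ (50 * (n.+1 * N))); first by nia.
apply: (@listorthants_halts _ n) => //.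
move=> s1 ag1 [O [O_uniq szO memO] sO].
(* The default [false] is never reached, since the listed words have length [n]. *)
pose row_of (w : bitseq) : orthant n := (\row_i nth false w i)%R.
pose Os := map row_of O.
have szOs : size Os = N by rewrite size_map.
have row_ofK w : w \in O -> enc_rv R (row_of w) = enc_bits R w.
  rewrite memO => /eqP sz_w; congr enc_bits.
  apply: (@eq_from_nth _ false); first by rewrite size_map size_enum_ord sz_w.
  rewrite size_map size_enum_ord => i lt_in.
  by rewrite (nth_map (Ordinal lt_in)) ?size_enum_ord // mxE nth_enum_ord.
have Os_uniq : uniq Os.
  rewrite map_inj_in_uniq // => w w'; rewrite !memO => /eqP sz_w /eqP sz_w' eq_r.
  apply: (@eq_from_nth _ false); first by rewrite sz_w sz_w'.
  rewrite sz_w => i lt_in.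
  by have /rowP/(_ (Ordinal lt_in)) := eq_r; rewrite !mxE.
have memOs sigma : sigma \in Os.
  apply/mapP; exists [seq sigma ord0 i | i <- enum 'I_n].
    by rewrite memO size_map size_enum_ord.
  apply/rowP => i; rewrite mxE (nth_map i) ?size_enum_ord //.
  by rewrite nth_ord_enum.
have {}sO : s1 "orthants" = enc_list (map (@enc_rv R n) Os).
  by rewrite sO -map_comp; congr enc_list; apply/eq_in_map => w /row_ofK.
have s1A : s1 "A" = enc_list [seq enc_column R (expmx p) j | j <- enum 'I_t].
  by rewrite ag1.
have s1b : s1 "b" = enc_list [seq Atom (coefv p ord0 j) | j <- enum 'I_t].
  by rewrite ag1.
apply: halts_assign_seq => /=; first by nia.
(* The reserve of 70 covers 50 for the listing and 20 for the assignments before and after the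
   loop. *)
apply: (@halts_seq _ (B - 70 * (n.+1 * N))); first by nia.
pose step := insert (@swap_le t sw) (@signvec R p).
(* Invariant: inserting the remaining orthants into the current [M] gives the final result. The body
   may make two comparisons for each of at most [N] pairs, whence [60 * t.+1]. *)
apply: (@halts_foreach _ _ (@enc_rv R n) (fun rest s' =>
   exists2 M, s' "M" = enc_output R M &
     size M + size rest <= N /\ foldl step M rest = foldl step [::] Os)
  (100 * (t.+1 * n.+1) + 30 + N * (60 * t.+1 + 40)) Os) => //.
- rewrite szOs /=; nia.
- by exists [::] => //; rewrite szOs.
- move=> sigma rest s2 ag2 [M sM [szM IH]].
  apply: (@halts_seq _ (100 * (t.+1 * n.+1))); first by nia.
  apply: (@computev_halts _ n t (expmx p) (coefv p) sigma) => //.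
  + by rewrite !updE // ag2.
  + by rewrite !updE // ag2.
  move=> s3 ag3; set v := sign_row _ _ _ => sv.
  apply: halts_assign_seq => /=; first by nia.
  apply: halts_assign_seq => /=; first by nia.
  apply: (@halts_seq _ (4 + N * (60 * t.+1 + 38))); first by nia.
  pose cmp : _ -> 'rV[bool]_t * orthant n -> _ := compare_pair (@swap_le t sw) v.
  apply: (@halts_foreach _ _
    (fun m : 'rV[bool]_t * orthant n => Defs.Cons (enc_rv R m.1) (enc_rv R m.2))
    (fun rest s' => exists2 bK,
       s' "minimal" = enc_bool R bK.1 /\ s' "kept" = enc_output R bK.2 &
       foldl cmp bK rest = scan (@swap_le t sw) v M)
    (60 * t.+1 + 30) M) => //.
  + by rewrite /= !updE // ag3 // !updE.
  + have : size M <= N by lia.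
    by move=> leM; apply: leq_add => //; apply: leq_mul => //; lia.
  + by exists (true, [::]).
  + move=> m rest' s4 ag4 [[b K] [/= smin sK] IH'].
    have s4v : s4 "v" = enc_rv R v by rewrite ag4 // !updE.
    apply: halts_assign_seq => /=; first by lia.
    apply: (@halts_seq _ (60 * t.+1 + 15)); first by lia.
    (* The bit [k] records whether the pair survives, so that all outcomes of the comparisons share
       the final test of [keep]. *)
    suff: halts (If (V "minimal") ("e" ::= EHd (V "pair");;
       SwapLeq sw "e <= v" "e" "v";;
       If (V "e <= v") ("minimal" ::= EFalse)
         (SwapLeq sw "v <= e" "v" "e";; If (V "v <= e") ("keep" ::= EFalse) Skip)) Skip)
      (update (update (update s4 "pair" (Defs.Cons (enc_rv R m.1) (enc_rv R m.2))) "todo pair"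
         (enc_output R rest')) "keep" (enc_bool R true)) (60 * t.+1 + 15)
      (fun s' => exists2 k, s' "keep" = enc_bool R k &
        s' "minimal" = enc_bool R (cmp (b, K) m).1 /\
        (cmp (b, K) m).2 = if k then m :: K else K).
      move=> h; apply: halts_agree; apply: halts_weaken h _ _ => // s5.
      move=> [k s5k [s5min cmpE]] ag5; apply: halts_if => /=; first by lia.
      rewrite s5k truth_enc_bool.
      case: k s5k cmpE => s5k cmpE.
        apply: halts_assign => /=; first by lia.
        exists (cmp (b, K) m); rewrite ?IH' //= updE ?updE // s5min; split=> //.
        by rewrite cmpE !ag5 // !updE // sK.
      apply: halts_skip; first by lia.
      exists (cmp (b, K) m); rewrite ?IH' //=; split=> //.
      by rewrite cmpE !ag5 // !updE // sK.
    apply: halts_if => /=; first by lia.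
    rewrite !updE // smin truth_enc_bool /cmp /compare_pair /=.
    case: b smin {IH'} => smin; last first.
      by apply: halts_skip; [lia | exists true].
    apply: halts_assign_seq => /=; first by lia.
    set s5 := update _ "e" _.
    have s5e : s5 "e" = enc_rv R m.1 by rewrite /s5 !updE.
    have s5v : s5 "v" = enc_rv R v by rewrite /s5 !updE.
    apply: (@halts_seq _ (30 * t.+1)); first by lia.
    apply: (@swapleq_halts t sw m.1 v) => // s6 ag6 s6r.
    apply: halts_if => /=; first by lia.
    rewrite s6r truth_enc_bool; case: ifP => ev.
      apply: halts_assign => /=; first by lia.
      by exists true; rewrite ?updE //= ag6 // /s5 !updE.
    apply: (@halts_seq _ (30 * t.+1)); first by lia.
    apply: (@swapleq_halts t sw v m.1) => //; rewrite ?ag6 // => s7 ag7 s7r.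
    apply: halts_if => /=; first by lia.
    rewrite s7r truth_enc_bool; case: ifP => ve.
      apply: halts_assign => /=; first by lia.
      by exists false; rewrite ?updE //= ag7 // ag6 // /s5 !updE.
    apply: halts_skip => /=; first by lia.
    by exists true; rewrite ag7 // ag6 // /s5 !updE.
  + move=> s4 ag4 [[b K] [/= smin sK] scanM].
    have s4v : s4 "v" = enc_rv R v by rewrite ag4 // !updE.
    have s4s : s4 "sigma" = enc_rv R sigma by rewrite ag4 // !updE // ag3.
    have stepE : step M sigma = if b then (v, sigma) :: K else K.
      by rewrite /step /insert -scanM.
    apply: halts_assign_seq => /=; first by nia.
    apply: halts_if => /=; first by nia.
    rewrite !updE // smin truth_enc_bool.
    have szs : size (step M sigma) + size rest <= N.
      apply: leq_trans szM; rewrite /= addnS -addSn leq_add2r; exact: size_insert.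
    move: stepE; case: (b) => stepE.
      apply: halts_assign; first by rewrite /=; nia.
      exists (step M sigma); last by [].
      by rewrite stepE updE /= !updE // s4v s4s sK.
    apply: halts_skip; first by nia.
    by exists (step M sigma) => //; rewrite stepE updE sK.
- move=> s2 ag2 [M sM [_ ME]]; apply: halts_assign => /=; first by nia.
  by exists Os; split=> //; rewrite -ME -sM.
Qed.

End MinimalOrthants.

(** * Fixed-parameter tractability *)

(** The parameter factor of the time bound must be computable in the same model; each round puts
    four items in place of one. *)
Definition Expn4 : cmd :=
  "out" ::= ECons ENil ENil ;;
  Foreach "i" (V "in") (
    "longer" ::= ENil ;;
    Foreach "s" (V "out") (
      "longer" ::= ECons ENil (ECons ENil (ECons ENil (ECons ENil (V "longer"))))) ;;
    "out" ::= V "longer").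

Lemma computable_expn4 (R : numDomainType) : computable R (expn 4).
Proof.
exists Expn4 => n.
suff [T [s [ex _ res]]]: halts Expn4 (init (enc_unary R n))
    (10 + n * (8 + (10 + 4 ^ n * 30))) (fun s => result s = enc_unary R (4 ^ n)).
  by exists T, s.
apply: halts_assign_seq => //.
apply: (@halts_foreach _ _ id (fun rest s =>
    size rest <= n /\ s "out" = enc_unary R (4 ^ (n - size rest)))
  (10 + 4 ^ n * 30) (nseq n (@Defs.Nil R))) => //.
- by rewrite map_id.
- by rewrite size_nseq /=; lia.
- by rewrite size_nseq subnn.
- move=> y rest s _ [/= le_n sout].
  apply: halts_assign_seq => //.
  have le4 : 4 ^ (n - (size rest).+1) <= 4 ^ n by rewrite leq_exp2l ?leq_subr.
  apply: (@halts_seq _ (4 + 4 ^ n * 30)); first by rewrite /=; lia.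
  apply: (@halts_foreach _ _ id (fun rest' s =>
      exists2 k, s "longer" = enc_unary R k &
        k + 4 * size rest' = 4 * 4 ^ (n - (size rest).+1))
    10 (nseq (4 ^ (n - (size rest).+1)) (@Defs.Nil R))) => //.
  + by rewrite /= !updE // sout map_id.
  + by rewrite size_nseq /=; lia.
  + by exists 0; rewrite ?size_nseq.
  + move=> y' rest' s1 _ [k sk kE]; apply: halts_assign => //.
    exists k.+4; last by rewrite -kE /=; lia.
    by rewrite updE /= !updE // sk.
  + move=> s1 _ [k sk kE]; apply: halts_assign; first by rewrite /=; lia.
    split; first by lia.
    by rewrite updE /= sk -[k]addn0 kE -expnS subnSK.
- by move=> s _ [_]; rewrite subn0.
Qed.

(** * Minimality and the order on effective coefficients *)

Lemma bitle_refl t : reflexive (@bitle t).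
Proof. by move=> u; apply/forallP => j; apply: implybb. Qed.

Lemma bitle_trans t : transitive (@bitle t).
Proof.
move=> v u w /forallP uv /forallP vw; apply/forallP => j.
by apply/implyP => /(implyP (uv j)) /(implyP (vw j)).
Qed.

Lemma bitle_anti t : antisymmetric (@bitle t).
Proof.
move=> u v /andP[/forallP uv /forallP vu]; apply/rowP => j.
by move: (uv j) (vu j); case: (u _ _); case: (v _ _).
Qed.

Section Correctness.
Variables (R : realType) (p : sparsePoly R).

Lemma rv_le_anti d (T : porderType d) t (u v : 'rV[T]_t) :
  rv_le u v -> rv_le v u -> u = v.
Proof.
by move=> uv vu; apply/rowP => j; apply/eqP; rewrite eq_le uv vu.
Qed.

(** Both orders are antisymmetric, so an equivalence of comparisons is also one of equalities, and
    minimality for [g] is minimality of sign vectors. *)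
Lemma lists_minimal_foldl sw d (T : porderType d) t
    (g : orthant (nvars p) -> 'rV[T]_t) (Os : seq (orthant (nvars p))) :
    (forall x y, rv_le (g x) (g y) <->
                 swap_le sw (signvec x) (signvec y)) ->
    (forall sigma, sigma \in Os) ->
  lists_minimal g (foldl (insert (@swap_le _ sw) (@signvec R p)) [::] Os).
Proof.
set le := @swap_le _ sw; set vec := @signvec R p => gE memOs.
have le_refl : reflexive le by rewrite /le /swap_le => u; case: (sw); apply: bitle_refl.
have le_trans : transitive le.
  rewrite /le /swap_le => v u w; case: (sw) => uv vw; last exact: bitle_trans uv vw.
  exact: bitle_trans vw uv.
have le_anti u v : le u v -> le v u -> u = v.
  by rewrite /le /swap_le; case: (sw) => uv vu; apply: bitle_anti; rewrite uv vu.
have geq x y : vec x = vec y -> g x = g y.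
  move=> xy; have le_xy : le (vec x) (vec y) /\ le (vec y) (vec x) by rewrite xy.
  by apply: rv_le_anti; apply/gE; case: le_xy.
have vecK x y : g x = g y -> vec x = vec y.
  by move=> xy; apply: le_anti; apply/gE; rewrite xy => j.
have [D DE [M_uniq ac Mv dom]] := minimal_pairs_foldl vec le_refl le_trans Os.
set M := foldl _ _ _ in M_uniq ac Mv dom *.
have {}dom x : exists2 m, m \in M & le m.1 (vec x) by apply: dom; rewrite DE.
split=> // [m mM|x x_min].
  split=> [|y /gE ym]; first exact: Mv.
  (* For [y] below [m], some [m'] of [M] lies below [y]; the antichain property forces it to be [m],
     which squeezes [y]. *)
  have [m' m'M m'y] := dom y.
  have m'm : m' = m by apply: ac => //; rewrite (Mv m) //; apply: le_trans m'y ym.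
  by apply: geq; apply: le_anti => //; rewrite -(Mv m) // -m'm.
have [m mM mx] := dom x; exists m.
have gm : g m.2 = g x by apply: x_min; apply/gE; rewrite -[vec m.2]Mv.
split=> // m' [m'M gm']; apply: ac => //.
by rewrite !Mv // (vecK m.2 m'.2) // gm gm'.
Qed.

Lemma rv_le_signvec x y :
  rv_le (signvec x) (signvec y) <-> swap_le false (signvec x) (@signvec R p y).
Proof.
have leE (a b : bool) : (a <= b)%O = (a ==> b) by case: a; case: b.
by split=> [xy | /forallP xy j]; [apply/forallP => j; rewrite -leE | rewrite leE].
Qed.

(** Writing a coefficient as its sign times its absolute value moves [neg] into the exponent, of
    which only the parity counts. *)
Lemma effcoefE x j :
  effcoef x ord0 j = ((-1) ^+ (@signvec R p x ord0 j) * `|coefv p ord0 j|)%R.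
Proof.
rewrite !mxE oddD oddb signr_addb signr_odd -mulrA; congr (_ * _)%R.
exact: numEsign.
Qed.

Lemma rv_le_effcoef x y :
  rv_le (effcoef x) (effcoef y) <-> swap_le true (signvec x) (@signvec R p y).
Proof.
have le_j j : (effcoef x ord0 j <= effcoef y ord0 j)%R
    = (signvec y ord0 j ==> @signvec R p x ord0 j).
  have: (0 < `|coefv p ord0 j|)%R by rewrite normr_gt0 coefv_neq0.
  rewrite !effcoefE; move: `|_|%R => a a_gt0.
  case: (signvec y _ _); case: (signvec x _ _); rewrite /= ?expr1 ?expr0 ?mulN1r ?mul1r ?lexx //.
    (* The case [a <= - a], which fails because the coefficient is nonzero. *)
    by apply/negbTE; rewrite -ltNge; lra.
  by lra.
by split=> [xy | /forallP xy j]; [apply/forallP => j; rewrite -le_j | rewrite le_j].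
Qed.

Lemma size_lt_dsize (l : seq (data R)) : size l < dsize (enc_list l).
Proof. by elim: l => //= d l IH; rewrite ltnS (leq_trans IH) ?leq_addl. Qed.

End Correctness.

Lemma minimal_orthants_fpt (R : realType) sw d (T : porderType d)
    (dim : sparsePoly R -> nat)
    (g : forall p : sparsePoly R, orthant (nvars p) -> 'rV[T]_(dim p)) :
    (forall p x y, rv_le (g p x) (g p y) <->
                   swap_le sw (signvec x) (signvec y)) ->
  fpt_by (@enc_input R) (@nvars R)
    (fun p out =>
       exists2 M : seq ('rV[bool]_(nterms p) * orthant (nvars p)),
         out = enc_output R M & lists_minimal (g p) M)
    (MinimalOrthants (SwapLeq sw)).
Proof.
move=> gE; exists (expn 4), 1000, 2; split=> [|p]; first exact: computable_expn4.
have [Os [D [s [_ memOs ex le_D res]]]] := minimal_orthants_halts p sw.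
exists D, s; split=> //; first by eexists; [exact: res | exact: lists_minimal_foldl].
(* Both [t.+1] and [n.+1] are at most the input size, as the input contains the coefficient list and
   [n] in unary; hence the exponent 2. *)
apply: leq_trans le_D _; rewrite !leq_mul2l /= -mulnn; apply/orP; right.
have := size_lt_dsize [seq Atom (coefv p 0%R j) | j <- enum 'I_(nterms p)].
have := size_lt_dsize (nseq (nvars p) (@Defs.Nil R)).
rewrite size_map size_enum_ord size_nseq => lt_n lt_t.
by apply: leq_mul; rewrite /enc_input /= /enc_unary; lia.
Qed.

(* The vectors (v_j) of the algorithm are compared entrywise, in the first
   part as signs (1 = negative is below 0 = nonnegative), which makes the
   minimal vectors those of the minimal effective coefficient vectors; in the
   second part as plain bits (0 below 1). *)
Theorem mainTheorem2 (R : realType) :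
  fpt_by (@enc_input R) (@nvars R)
    (fun (p : sparsePoly R) (out : data R) =>
       exists2 M : seq ('rV[bool]_(nterms p) * orthant (nvars p)),
         out = enc_output R M & lists_minimal (@effcoef R p) M)
    (MinimalOrthants SignLeq)
  /\
  fpt_by (@enc_input R) (@nvars R)
    (fun (p : sparsePoly R) (out : data R) =>
       exists2 M : seq ('rV[bool]_(nterms p) * orthant (nvars p)),
         out = enc_output R M & lists_minimal (@signvec R p) M)
    (MinimalOrthants BitLeq).
Proof.
split.
- exact: (@minimal_orthants_fpt R true _ _ _ (@effcoef R) (@rv_le_effcoef R)).
- exact: (@minimal_orthants_fpt R false _ _ _ (@signvec R) (@rv_le_signvec R)).
Qed.
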